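(* Let $\kappa$ be an infinite cardinal. Every uniformly convex real normed space $X$ of density $\kappa$ is $(<\kappa)$-$\varphi_X$-octahedral.
   Context: $B_X$, $S_X$ are the closed unit ball and unit sphere of $X$; $\mathrm{dens}(X)$, the density of $X$, is the smallest cardinality of a subset of $X$ whose linear span is dense in $X$ (so $\mathrm{dens}(Z)<\omega$ means $Z$ is finite-dimensional). $X$ is uniformly convex if $\inf\{1-\|\frac{x+y}{2}\|:x,y\in B_X,\ \|x-y\|\ge\varepsilon\}>0$ for all $\varepsilon\in(0,2]$. The tangential modulus of convexity is $\varphi_X(t)=\inf\{\|x+tv\|-1:x\in S_X,\ f\in X^*\setminus\{0\}\text{ with }f(x)=\|f\|,\ v\in\ker(f)\cap S_X\}$, $t\ge0$. For a function $\phi:[0,\infty)\to[0,\infty)$ that is a positive modulus (i.e. $\phi(0)=0$, $\phi$ is continuous at $0$, $t\mapsto\phi(t)/t$ is non-decreasing on $(0,\infty)$, and $\phi(t)>0$ for $t>0$; $\varphi_X$ is one when $X$ is uniformly convex of dimension at least $2$), $X$ is $(<\kappa)$-$\phi$-octahedral if for every $\varepsilon>0$ and every subspace $Z$ of $X$ with $\mathrm{dens}(Z)<\kappa$ there is $x\in S_X$ such that $\|z+\lambda x\|\ge(1-\varepsilon)(1+\phi(|\lambda|))$ for all $z\in S_Z$ and $\lambda\in\mathbb{R}$. *)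

(* Defs.v *)
From HB Require Import structures.
From mathcomp Require Import all_boot all_order all_algebra.
From mathcomp Require Import all_classical all_reals all_analysis.

Set Implicit Arguments.
Unset Strict Implicit.
Unset Printing Implicit Defensive.

Import Order.TTheory GRing.Theory Num.Theory.
Import numFieldNormedType.Exports.

Local Open Scope classical_set_scope.
Local Open Scope card_scope.
Local Open Scope ring_scope.

Definition unit_ball (R : realType) (X : normedModType R) : set X :=
  [set x | `|x| <= 1].
Arguments unit_ball {R} X.

Definition unit_sphere (R : realType) (X : normedModType R) : set X :=
  [set x | `|x| = 1].
Arguments unit_sphere {R} X.

Definition linear_span (R : realType) (X : normedModType R) (A : set X) :
    set X :=
  smallest (fun S : set X => submod_closed [in S]) A.

Definition densely_spans (R : realType) (X : normedModType R) (Z A : set X) :=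
  A `<=` Z /\ Z `<=` closure (linear_span A).

(* A cardinal is represented by an arbitrary set having that cardinality;
   [is_density Z kappa] means dens(Z) = kappa. *)
Definition is_density (R : realType) (X : normedModType R) (Z : set X)
    (T : Type) (kappa : set T) :=
  (exists2 A : set X, densely_spans Z A & A #= kappa) /\
  (forall A : set X, densely_spans Z A -> kappa #<= A).

Definition density_lt (R : realType) (X : normedModType R) (Z : set X)
    (T : Type) (kappa : set T) :=
  exists D : set X, [/\ is_density Z D, D #<= kappa & ~~ (kappa #<= D)].

(* The infimum is taken in the extended reals so that it is +oo when no pair
   (x, y) is admissible, i.e. when X is the zero space; the infimum [inf] of
   the empty set in R would be 0. *)
Definition convexity_modulus (R : realType) (X : normedModType R) (eps : R) :
    \bar R :=
  ereal_inf [set (1 - `|2^-1 *: (p.1 + p.2)|)%:E | p in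
    [set p : X * X | [/\ unit_ball X p.1, unit_ball X p.2
                       & eps <= `|p.1 - p.2|]]].
Arguments convexity_modulus {R} X eps.

Definition uniformly_convex (R : realType) (X : normedModType R) :=
  forall eps : R, 0 < eps <= 2 -> (0 < convexity_modulus X eps)%E.
Arguments uniformly_convex {R} X.

(* Meaningful when f is continuous, the set being then bounded. *)
Definition dual_norm (R : realType) (X : normedModType R)
    (f : {linear X -> R^o}) : R :=
  sup [set `|f x| | x in unit_ball X].

(* When X has dimension at least 2 the set below is nonempty, and it is always
   bounded below by 0; in dimension at most 1 it is empty and the value is the
   default one, 0. *)
Definition tangential_modulus (R : realType) (X : normedModType R) (t : R) :
    R :=
  inf [set r : R | exists (x v : X) (f : {linear X -> R^o}),
    [/\ unit_sphere X x,
        continuous f /\ (exists y, f y != 0),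
        f x = dual_norm f,
        f v = 0 /\ unit_sphere X v
      & r = `|x + t *: v| - 1]].
Arguments tangential_modulus {R} X t.

(* [phi] matters only on nonnegative reals. *)
Definition octahedral_lt (R : realType) (X : normedModType R)
    (T : Type) (kappa : set T) (phi : R -> R) :=
  forall (eps : R) (Z : set X), 0 < eps -> submod_closed [in Z] ->
    density_lt Z kappa ->
    exists2 x : X, unit_sphere X x &
      forall (z : X) (lambda : R), Z z -> unit_sphere X z ->
        (1 - eps) * (1 + phi `|lambda|) <= `|z + lambda *: x|.
Arguments octahedral_lt {R} X {T} kappa phi.

(* Main.v *)
Require Import Defs.
From HB Require Import structures.
From mathcomp Require Import all_boot all_order all_algebra.
From mathcomp Require Import all_classical all_reals all_analysis.
From mathcomp Require Import ring lra.

Set Implicit Arguments.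
Unset Strict Implicit.
Unset Printing Implicit Defensive.

Import Order.TTheory GRing.Theory Num.Theory.
Import numFieldNormedType.Exports.

Local Open Scope classical_set_scope.
Local Open Scope card_scope.
Local Open Scope ring_scope.

(** Let [Z] be spanned, up to closure, by [A] with [#|A| < dens X], and let
    [d > 0] be small.  Two ingredients give the theorem.

    Estimate ([tangential_estimate]).  If a unit vector [z] is within [d] of
    [u], if [f] is a functional of norm at most 1 with [f u = |u|], and if [x]
    is a unit vector with [|f x| <= d], then, after normalising [u] and
    projecting [x] to the kernel of [f] along [u], the pair becomes admissible
    in the infimum defining the tangential modulus.  The perturbation costs
    [O(d (1 + |l|))], while the norm to be estimated is at least
    [max(1, |l| - 1)], so the loss is a factor [1 - O(d)] uniformly in [l].
    It therefore suffices to find a [d]-net [N] of the unit sphere of [Z] and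
    one unit vector [x] that is almost annihilated by a norming functional of
    each [u] in [N].  Norming functionals come from the Hahn-Banach theorem
    ([norming_functional]).

    Almost annihilated vector.  If [A] is finite, the unit sphere of [Z] has a
    finite net, and finitely many functionals have a common nonzero kernel
    vector because [X] is infinite-dimensional ([finite_net_orthogonal]).
    If [A] is infinite, take for [N] the rational combinations of [A]; there are
    only [#|A|] of them ([embeds_seq]: finite words over an infinite alphabet
    are no more numerous than its letters).  If no unit vector were almost
    annihilated by all the functionals [f_u], they would form a norming family:
    [d |x| <= sup_u |f_u x|].  In a reflexive space such a family has dense span
    in the dual, so that [dens X <= #|A|].  Reflexivity is replaced here by the
    computation behind the Milman-Pettis theorem ([norming_family_dense]): among
    the points whose values under finitely many [f_u] are close to those of [x],
    those of almost minimal norm are close to each other, by uniform convexity,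
    and hence close to [x] for the norm [sup_u |f_u|].  Such points can be taken in a set
    of cardinality [#|A|] that is dense for the weak topology of the [f_u] and
    of the norm ([weakly_dense_family]).  That set is then dense in [X],
    contradicting [#|A| < dens X]. *)

(** * Finite words over an infinite alphabet *)

Definition embeds (U V : Type) := exists f : U -> V, injective f.

(** Comparability of cardinals: a maximal partial injection, seen as a graph,
    must exhaust one of the two sides. *)
Lemma embeds_total (U V : Type) : embeds U V \/ embeds V U.
Proof.
pose P : set (set (U * V)) :=
  [set G | forall p q, G p -> G q -> p.1 = q.1 <-> p.2 = q.2].
have [|G [PG Gmax]] := @Zorn_bigcup _ P.
  move=> F FP Ftot p q [X FX Xp] [Y FY Yq].
  by have [XY|YX] := Ftot _ _ FX FY;
    [apply: (FP _ FY) => //; exact: XY|apply: (FP _ FX) => //; exact: YX].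
have [Gu|/existsNP[u Gu]] := pselect (forall u : U, exists v, G (u, v)).
  left; have [f Gf] := boolp.choice Gu; exists f => x y fxy.
  by apply/(PG _ _ (Gf x) (Gf y)).
have [Gv|/existsNP[v Gv]] := pselect (forall v : V, exists u, G (u, v)).
  right; have [f Gf] := boolp.choice Gv; exists f => x y fxy.
  by apply/(PG _ _ (Gf x) (Gf y)).
exfalso; apply: (Gmax (G `|` [set (u, v)])).
  split; first by move=> p Gp; left.
  by move=> /(_ (u, v)) H; apply: Gu; exists v; apply: H; right.
have fresh p : G p -> p.1 <> u /\ p.2 <> v.
  by case: p => a b Gp; split => /= e; [apply: Gu; exists b|apply: Gv; exists a];
    rewrite -e.
move=> p q [Gp|->] [Gq|->] //=; first exact: PG.
- by have [? ?] := fresh _ Gp; split.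
- by have [n1 n2] := fresh _ Gq; split=> /esym.
Qed.

Lemma sval_inj (U : Type) (P : U -> Prop) : injective (@sval U P).
Proof.
by move=> [x px] [y py] /= xy; subst y; rewrite (Prop_irrelevance px py).
Qed.

Lemma card_le_embeds (U V : Type) : [set: U] #<= [set: V] -> embeds U V.
Proof.
move=> /card_leP/injfunPex[i _ iinj].
exists (fun u => val (i (SigSub (mem_set (I : [set: U] u))))) => u v /val_inj.
by move=> /iinj => /(_ (mem_set I) (mem_set I)) [].
Qed.

Section SeqEmbedding.
Variable K : eqType.

Definition word_on (A : set K) (s : seq K) := forall x, x \in s -> A x.

(** The partial objects of the Zorn argument for [embeds_seq]: injective
    codings of the words over [alphabet] by letters of [alphabet]. *)
Record coding := Coding {
  alphabet : set K;
  code : seq K -> K;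
  code_alphabet : forall s, word_on alphabet s -> alphabet (code s);
  code_inj : forall s t, word_on alphabet s -> word_on alphabet t ->
    code s = code t -> s = t }.

Definition coding_le (c d : coding) := alphabet c `<=` alphabet d /\
  forall s, word_on (alphabet c) s -> code c s = code d s.

Lemma sub_word (A B : set K) s : A `<=` B -> word_on A s -> word_on B s.
Proof. by move=> AB As x /As /AB. Qed.

Lemma word_cons (A : set K) x s : word_on A (x :: s) <-> A x /\ word_on A s.
Proof.
split=> [As|[Ax As] y].
  split; first by apply: As; rewrite mem_head.
  by move=> y ys; apply: As; rewrite in_cons ys orbT.
by rewrite in_cons => /predU1P[->//|/As].
Qed.

Lemma word_map (A B : set K) (h : K -> K) s :
  (forall x, A x -> B (h x)) -> word_on A s -> word_on B (map h s).
Proof. by move=> AB As _ /mapP[y ys ->]; apply/AB/As. Qed.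

Lemma map_word_inj (A : set K) (T : Type) (h : K -> T) :
  (forall x y, A x -> A y -> h x = h y -> x = y) ->
  forall s t, word_on A s -> word_on A t -> map h s = map h t -> s = t.
Proof.
move=> hinj; elim=> [|x s IH] [|y t] //= /word_cons[Ax As] /word_cons[Ay At].
by move=> [/(hinj _ _ Ax Ay) -> /(IH _ As At) ->].
Qed.

Lemma nat_coding : infinite_set [set: K] -> inhabited coding.
Proof.
move=> /infiniteP/card_le_embeds[i iinj].
have [j ij] : exists j : K -> nat, forall n, j (i n) = n.
  have : forall x, exists m, forall n, x = i n -> m = n.
    move=> x; have [[n ->]|nx] := pselect (exists n, x = i n).
      by exists n => m /iinj.
    by exists 0%N => n xn; exfalso; apply: nx; exists n.
  by move=> /boolp.choice[j jP]; exists j => n; exact: jP.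
constructor; apply: (@Coding (range i) (fun s => i (pickle (map j s)))).
  by move=> s _; exists (pickle (map j s)).
move=> s t si ti /iinj /(pcan_inj pickleK); apply: map_word_inj si ti.
by move=> _ _ [m _ <-] [n _ <-]; rewrite !ij => ->.
Qed.

Lemma coding_chain (C : set coding) : C !=set0 -> total_on C coding_le ->
  exists d, forall c, C c -> coding_le c d.
Proof.
move=> [c0 Cc0] Ctot.
pose U := \bigcup_(c in C) alphabet c.
have Uword s : word_on U s -> exists2 c, C c & word_on (alphabet c) s.
  elim: s => [|x s IH]; first by exists c0.
  move=> /word_cons[[d Cd dx] /IH[c Cc cs]].
  have [[cd _]|[dc _]] := Ctot _ _ Cc Cd.
  - by exists d => //; apply/word_cons; split => //; exact: sub_word cs.
  - by exists c => //; apply/word_cons; split => //; exact: dc.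
have : forall s, exists y, forall c, C c -> word_on (alphabet c) s -> y = code c s.
  move=> s; have [[c Cc cs]|ns] := pselect (exists2 c, C c & word_on (alphabet c) s).
    exists (code c s) => d Cd ds.
    by have [[_ cd]|[_ dc]] := Ctot _ _ Cc Cd; [exact: cd|rewrite dc].
  by exists (code c0 s) => c Cc cs; exfalso; apply: ns; exists c.
move=> /boolp.choice[F FE].
have Uword2 s t : word_on U s -> word_on U t ->
    exists2 c, C c & word_on (alphabet c) s /\ word_on (alphabet c) t.
  move=> /Uword[c Cc cs] /Uword[d Cd dt].
  have [[cd _]|[dc _]] := Ctot _ _ Cc Cd.
  - by exists d => //; split => //; exact: sub_word cs.
  - by exists c => //; split => //; exact: sub_word dt.
unshelve eexists.
  apply: (@Coding U F).
    by move=> s /Uword[c Cc cs]; exists c => //; rewrite (FE _ c)//; exact: code_alphabet.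
  move=> s t Us Ut; have [c Cc [cs ct]] := Uword2 _ _ Us Ut.
  by rewrite (FE _ c)// (FE _ c)//; exact: code_inj.
move=> c Cc; split => /=; first by move=> x cx; exists c.
by move=> s cs; rewrite (FE _ c).
Qed.

(** Letters of the alphabet and letters of [B] are both recoded inside the
    alphabet, by words of length 1 and 2 respectively: a coding already contains
    the fact that doubling a set does not increase its cardinality. *)
Lemma coding_doubling (c : coding) (B : set K) (b : K -> K) :
  (forall x, ~ alphabet c x -> alphabet c (b x)) ->
  (forall x y, B x -> B y -> b x = b y -> x = y) ->
  exists h : K -> K,
    (forall x, alphabet c (h x)) /\
    (forall x y, (alphabet c `|` B) x -> (alphabet c `|` B) y -> h x = h y -> x = y).
Proof.
move=> bA binj.
exists (fun x => if pselect (alphabet c x) then code c [:: x] else code c [:: b x; b x]).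
have one x : alphabet c x -> word_on (alphabet c) [:: x].
  by move=> Ax; apply/word_cons; split.
have two x : ~ alphabet c x -> word_on (alphabet c) [:: b x; b x].
  by move=> /bA Ax; apply/word_cons; split => //; exact: one.
split=> [x|x y xAB yAB].
  by case: pselect => Ax; apply: code_alphabet; [exact: one|exact: two].
case: pselect => Ax; case: pselect => Ay.
- by move=> /(code_inj (one _ Ax) (one _ Ay)) [].
- by move=> /(code_inj (one _ Ax) (two _ Ay)).
- by move=> /(code_inj (two _ Ax) (one _ Ay)).
- move=> /(code_inj (two _ Ax) (two _ Ay)) [bxy _].
  by case: xAB yAB => [//|Bx] [//|By]; exact: binj bxy.
Qed.

Lemma maximal_coding : infinite_set [set: K] ->
  exists c : coding, forall d, coding_le c d -> coding_le d c.
Proof.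
move=> /nat_coding[c0].
have [| | |c cmax] := @ZL_preorder coding c0 (fun c d => `[< coding_le c d >]).
- by move=> c; apply/asboolP; split.
- move=> c d e /asboolP[dc dcE] /asboolP[ce ceE]; apply/asboolP; split.
    by move=> x /dc /ce.
  by move=> s ds; rewrite dcE// ceE//; exact: sub_word ds.
- move=> C Ctot; have [[c Cc]|C0] := pselect (C !=set0); last first.
    by exists c0 => c Cc; exfalso; apply: C0; exists c.
  have [||d dP] := @coding_chain C; first by exists c.
    by move=> e f Ce Cf; have [/asboolP|/asboolP] := Ctot _ _ Ce Cf; [left|right].
  by exists d => e Ce; apply/asboolP/dP.
- by exists c => d cd; apply/asboolP; apply: cmax; exact/asboolP.
Qed.

(** The complement of a maximal alphabet embeds in the alphabet: otherwise a
    disjoint copy of the alphabet could be adjoined, with the new words coded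
    inside the copy.  Hence all letters, and then all words, can be recoded in
    the maximal alphabet. *)
Theorem embeds_seq : infinite_set [set: K] -> embeds (seq K) K.
Proof.
move=> /maximal_coding[c cmax].
have [[b binj]|[b binj]] := embeds_total {x | ~ alphabet c x} {x | alphabet c x}.
  (* The complement embeds in the alphabet: recode every letter. *)
  pose b' x := if pselect (alphabet c x) is right nx then sval (b (exist _ x nx)) else x.
  have [|| h [hA hinj]] := @coding_doubling c (~` alphabet c) b'.
  - move=> x nx; rewrite /b'; case: pselect => // nx'; exact: (svalP (b _)).
  - move=> x y nx ny; rewrite /b'; case: pselect => // nx'; case: pselect => // ny'.
    by move=> /sval_inj => /binj; case.
  have hword s : word_on (alphabet c) (map h s).
    by apply: (@word_map setT) => // x _; exact: hA.
  exists (fun s => code c (map h s)) => s t /(code_inj (hword s) (hword t)).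
  by apply: (@map_word_inj setT) => // x y _ _; apply: hinj; rewrite setUv.
(* The alphabet embeds in its complement: extend the coding to a copy [B]. *)
pose b' x := if pselect (alphabet c x) is left cx then sval (b (exist _ x cx)) else x.
have b'N x : alphabet c x -> ~ alphabet c (b' x).
  by move=> cx; rewrite /b'; case: pselect => // cx'; exact: (svalP (b _)).
have b'inj x y : alphabet c x -> alphabet c y -> b' x = b' y -> x = y.
  move=> cx cy; rewrite /b'; case: pselect => // cx'; case: pselect => // cy'.
  by move=> /sval_inj => /binj; case.
exfalso; pose A := alphabet c; pose B := b' @` A.
have A0 : A (code c [::]) by exact: code_alphabet.
have : forall x, exists a, A a /\ (B x -> b' a = x).
  move=> x; have [[a Aa ax]|Bx] := pselect (B x); first by exists a.
  by exists (code c [::]).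
move=> /boolp.choice[g gP].
have [||h [hA hinj]] := @coding_doubling c B g.
- by move=> x _; have [] := gP x.
- by move=> x y Bx By gxy; rewrite -(proj2 (gP x) Bx) -(proj2 (gP y) By) gxy.
have hword s : word_on A (map h s) by apply: (@word_map setT) => // x _; exact: hA.
pose F s := if pselect (word_on A s) then code c s else b' (code c (map h s)).
have FA s : word_on (A `|` B) s -> (A `|` B) (F s).
  rewrite /F; case: pselect => As _; first by left; exact: code_alphabet.
  by right; exists (code c (map h s)) => //; exact: code_alphabet.
have Finj s t : word_on (A `|` B) s -> word_on (A `|` B) t -> F s = F t -> s = t.
  rewrite /F => ABs ABt; case: pselect => As; case: pselect => At.
  - exact: code_inj.
  - by move=> /= e; case: (b'N _ (code_alphabet (hword t))); rewrite -e; exact: code_alphabet.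
  - by move=> /= e; case: (b'N _ (code_alphabet (hword s))); rewrite e; exact: code_alphabet.
  - move=> /(b'inj _ _ (code_alphabet (hword s)) (code_alphabet (hword t))).
    by move=> /(code_inj (hword s) (hword t)); exact: (map_word_inj hinj).
have [|AB _] := cmax (Coding FA Finj).
- by split; [move=> x Ax; left|move=> s As /=; rewrite /F; case: pselect].
- have := @b'N (code c [::]) A0; apply; apply: AB => /=.
  by right; exists (code c [::]).
Qed.

End SeqEmbedding.

Section EmbeddingsIntoInfinite.
Variables (K : eqType) (K_infinite : infinite_set [set: K]).

Lemma embeds_words (U : Type) : embeds U K -> embeds (seq U) K.
Proof.
move=> [g ginj]; have [e einj] := embeds_seq K_infinite.
by exists (fun s => e (map g s)); apply: inj_comp => //; exact: inj_map.
Qed.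

Lemma embeds_option (U : Type) : embeds U K -> embeds (option U) K.
Proof.
move=> [g ginj]; have [e einj] := embeds_seq K_infinite.
exists (fun o => e (if o is Some u then [:: g u] else [::])).
by move=> [u|] [v|] /einj // [/ginj ->].
Qed.

Lemma embeds_prod_countable (U : Type) (C : countType) :
  embeds U K -> embeds (U * C) K.
Proof.
move=> [g ginj]; have [e einj] := embeds_seq K_infinite.
(* The countable component is stored in the length of a constant word. *)
exists (fun p => e (nseq (pickle p.2).+1 (g p.1))) => -[u c] [v d] /einj /= [].
by move=> /ginj -> /(congr1 size); rewrite !size_nseq => /(pcan_inj pickleK) ->.
Qed.

End EmbeddingsIntoInfinite.

Lemma embeds_card_le (U V : Type) : embeds U V -> [set: U] #<= [set: V].
Proof.
move=> [f finj].
have /card_eqPle[_ Uf] : f @` [set: U] #= [set: U].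
  by apply: inj_card_eq => u v _ _ /finj.
by apply: card_le_trans Uf _; exact: subset_card_le.
Qed.

(** * Norming functionals *)

Section NormingFunctional.
Variables (R : realType) (X : normedModType R).

(** Hahn-Banach is proved in the form that a minimal element among these
    functionals, for the pointwise order, is linear. *)
Record sublinear := Sublinear {
  sub_fun :> X -> R;
  sub_add : forall x y, sub_fun (x + y) <= sub_fun x + sub_fun y;
  sub_scale : forall a x, 0 <= a -> sub_fun (a *: x) = a * sub_fun x;
  sub_norm : forall x, sub_fun x <= `|x| }.

Lemma sub0 (p : sublinear) : p 0 = 0.
Proof. by rewrite -(scale0r 0) sub_scale// mul0r. Qed.

Lemma sub_ge (p : sublinear) x : - `|x| <= p x.
Proof.
have := sub_add p x (- x); rewrite subrr sub0.
have := sub_norm p (- x); rewrite normrN; lra.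
Qed.

(** The lower bound is the pointwise infimum; subadditivity compares values of
    two different members of the chain, and so uses that it is a chain. *)
Lemma sublinear_chain (C : set sublinear) : C !=set0 ->
  (forall p q, C p -> C q -> (forall x, p x <= q x) \/ (forall x, q x <= p x)) ->
  exists m : sublinear, forall p, C p -> forall x, m x <= p x.
Proof.
move=> [p0 Cp0] Ctot.
pose m x := inf [set p x | p in C].
have lb x : has_inf [set (p : sublinear) x | p in C].
  split; first by exists (p0 x), p0.
  by exists (- `|x|) => _ [p _ <-]; exact: sub_ge.
have mle p x : C p -> m x <= p x.
  by move=> Cp; apply: ge_inf; [exact: (lb x).2|exists p].
have mge x r : (forall p, C p -> r <= p x) -> r <= m x.
  by move=> H; apply: lb_le_inf; [exact: (lb x).1|move=> _ [p Cp <-]; exact: H].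
have m_add x y : m (x + y) <= m x + m y.
  rewrite -lerBlDl; apply: (mge) => p Cp.
  rewrite lerBlDr -lerBlDl; apply: mge => q Cq; rewrite lerBlDr.
  have [pq|qp] := Ctot _ _ Cp Cq.
    by apply: le_trans (mle _ _ Cp) _; have := sub_add p x y; have := pq x; lra.
  by apply: le_trans (mle _ _ Cq) _; have := sub_add q x y; have := qp y; lra.
have m_scale a x : 0 <= a -> m (a *: x) = a * m x.
  rewrite le_eqVlt => /predU1P[<-|a0].
    rewrite scale0r mul0r; apply/eqP; rewrite eq_le; apply/andP; split.
      by rewrite -(sub0 p0); exact: mle.
    by apply: mge => p _; rewrite sub0.
  apply/eqP; rewrite eq_le; apply/andP; split.
    rewrite -ler_pdivrMl//; apply: (mge) => p Cp.
    by rewrite ler_pdivrMl// -(sub_scale p x (ltW a0)); exact: mle.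
  by apply: mge => p Cp; rewrite (sub_scale p x (ltW a0)) ler_pM2l//; exact: mle.
have m_norm x : m x <= `|x| by exact: le_trans (mle _ _ Cp0) (sub_norm _ _).
by exists (Sublinear m_add m_scale m_norm) => p Cp x; exact: mle.
Qed.

(** The witness is [q x = inf_(t >= 0) (p (x + t u) - t p u)].  It serves twice:
    started from the norm it makes the final functional norm [u], and applied to
    a minimal functional it forces that functional to be odd. *)
Lemma sublinear_lower (p : sublinear) (u : X) :
  exists q : sublinear, (forall x, q x <= p x) /\ q (- u) <= - p u.
Proof.
pose S x := [set p (x + t *: u) - t * p u | t in [set t : R | 0 <= t]].
have lb x : has_inf (S x).
  split; first by exists (p (x + 0 *: u) - 0 * p u), 0 => /=.
  exists (- p (- x)) => _ [t /= t0 <-].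
  have := sub_add p (x + t *: u) (- x); rewrite addrAC subrr add0r sub_scale//; lra.
pose q x := inf (S x).
have qle x t : 0 <= t -> q x <= p (x + t *: u) - t * p u.
  by move=> t0; apply: ge_inf; [exact: (lb x).2|exists t].
have qge x r : (forall t, 0 <= t -> r <= p (x + t *: u) - t * p u) -> r <= q x.
  by move=> H; apply: lb_le_inf; [exact: (lb x).1|move=> _ [t t0 <-]; exact: H].
have qp x : q x <= p x by have := qle x 0 (lexx 0); rewrite scale0r addr0 mul0r subr0.
have q_ge0 : 0 <= q 0.
  by apply: qge => t t0; rewrite add0r sub_scale// subrr.
have q_add x y : q (x + y) <= q x + q y.
  rewrite -lerBlDl; apply: (qge) => t t0.
  rewrite lerBlDr -lerBlDl; apply: qge => s s0; rewrite lerBlDr.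
  apply: le_trans (qle (x + y) (s + t) (addr_ge0 s0 t0)) _.
  have := sub_add p (x + s *: u) (y + t *: u).
  rewrite addrACA -scalerDl; lra.
have q_scale a x : 0 <= a -> q (a *: x) = a * q x.
  rewrite le_eqVlt => /predU1P[<-|a0].
    rewrite scale0r mul0r; apply/eqP; rewrite eq_le q_ge0 andbT.
    by rewrite -(sub0 p); exact: qp.
  apply/eqP; rewrite eq_le; apply/andP; split.
    rewrite -ler_pdivrMl//; apply: (qge) => t t0.
    rewrite ler_pdivrMl//; apply: le_trans (qle (a *: x) (a * t) _) _.
      by rewrite mulr_ge0// ltW.
    by rewrite -scalerA -scalerDr (sub_scale p _ (ltW a0)) mulrBr mulrA.
  apply: qge => t t0; rewrite mulrC -ler_pdivlMr// mulrC.
  apply: le_trans (qle x (a^-1 * t) _) _.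
    by rewrite mulr_ge0// invr_ge0 ltW.
  have a'0 : 0 <= a^-1 by rewrite invr_ge0 ltW.
  rewrite mulrBr -(sub_scale p _ a'0) scalerDr !scalerA mulVf ?gt_eqF//.
  by rewrite scale1r mulrA.
have q_norm x : q x <= `|x| by exact: le_trans (qp x) (sub_norm _ _).
exists (Sublinear q_add q_scale q_norm); split => //=.
by have := qle (- u) 1 ler01; rewrite scale1r addNr sub0 mul1r sub0r.
Qed.

Lemma minimal_sublinear (p : sublinear) :
  exists m : sublinear, (forall x, m x <= p x) /\
    forall q : sublinear, (forall x, q x <= m x) -> forall x, m x <= q x.
Proof.
pose T := {q : sublinear | forall x, q x <= p x}.
pose ge (q r : T) := `[< forall x, sval r x <= sval q x >].
pose p0 : T := exist _ p (fun x => lexx (p x)).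
have [| | |m mmin] := @ZL_preorder T p0 ge.
- by move=> q; apply/asboolP.
- move=> q r s /asboolP qr /asboolP rs; apply/asboolP => x.
  exact: le_trans (rs x) (qr x).
- move=> C Ctot; have [[[q qp] Cq]|C0] := pselect (C !=set0); last first.
    by exists p0 => c Cc; exfalso; apply: C0; exists c.
  have [||m mP] := @sublinear_chain [set sval q | q in C].
  + by exists q, (exist _ q qp).
  + move=> _ _ [r Cr <-] [s Cs <-].
    by have [/asboolP|/asboolP] := Ctot _ _ Cr Cs; [right|left].
  have mp x : m x <= p x.
    by apply: le_trans (qp x); apply: mP; exists (exist _ q qp).
  exists (exist _ m mp) => r Cr; apply/asboolP => x /=.
  by apply: mP; exists r.
exists (sval m); split=> [|q qm]; first exact: svalP m.
have qp x : q x <= p x by exact: le_trans (qm x) (svalP m x).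
by have /asboolP := mmin (exist _ q qp) (asboolT qm).
Qed.

Lemma norming_functional (u : X) :
  exists f : {linear X -> R^o}, (forall x, `|f x| <= `|x|) /\ f u = `|u|.
Proof.
have [q [_ qu]] := sublinear_lower
  (Sublinear (@ler_normD _ X) (fun a x a0 => etrans (normrZ a x) (congr1 ( *%R^~ `|x|) (ger0_norm a0)))
     (fun x => lexx `|x|)) u.
have [m [mq mmin]] := minimal_sublinear q.
have mN x : m (- x) = - m x.
  have [r [rm rx]] := sublinear_lower m x.
  apply/eqP; rewrite eq_le (le_trans (mmin _ rm _) rx) /=.
  by have := sub_add m x (- x); rewrite subrr sub0; lra.
have mlin : linear (m : X -> R^o).
  have mD x y : m (x + y) = m x + m y.
    apply/eqP; rewrite eq_le sub_add /=.
    by have := sub_add m (- x) (- y); rewrite -opprD !mN; lra.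
  move=> a x y; rewrite mD; congr (_ + _).
  have [a0|a0] := leP 0 a; first exact: sub_scale.
  rewrite -[a]opprK scaleNr mN sub_scale ?oppr_ge0 ?ltW//.
  by rewrite scaleNr.
pose f : {linear X -> R^o} := HB.pack (m : X -> R^o) (GRing.isLinear.Build R X R^o *:%R m mlin).
exists f; split => [x|].
  rewrite ler_norml /=; apply/andP; split; first exact: sub_ge.
  exact: sub_norm.
apply/eqP; rewrite eq_le; apply/andP; split; first exact: sub_norm.
by have := mq (- u); move: qu; rewrite mN /f /=; lra.
Qed.

End NormingFunctional.

(** * The tangential estimate *)

Section Geometry.
Variables (R : realType) (X : normedModType R).
Implicit Types (x y z u v : X) (f : {linear X -> R^o}).

Lemma normalize_dist z : `|z| != 0 -> `| `|z|^-1 *: z - z| = `|1 - `|z| |.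
Proof.
move=> z0; have -> : `|z|^-1 *: z - z = (`|z|^-1 * (1 - `|z|)) *: z.
  by rewrite mulrBr mulr1 mulVf// scalerBl scale1r.
by rewrite normrZ normrM normrV ?unitfE// normr_id mulrAC mulVf// mul1r.
Qed.

Lemma normalized z : `|z| != 0 -> `| `|z|^-1 *: z| = 1.
Proof. by move=> z0; rewrite normrZ normrV ?unitfE// normr_id mulVf. Qed.

Lemma contraction_continuous f : (forall x, `|f x| <= `|x|) -> continuous f.
Proof.
move=> f1; apply: bounded_linear_continuous; apply/bounded_funP => r.
by exists r => x; exact: le_trans (f1 x).
Qed.

Lemma norming_dual_norm f u : (forall x, `|f x| <= `|x|) -> `|u| = 1 ->
  f u = 1 -> dual_norm f = 1.
Proof.
move=> f1 u1 fu; apply/eqP; rewrite eq_le; apply/andP; split.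
  apply: ge_sup; first by exists `|f u|, u => //=; rewrite /unit_ball /= u1.
  by move=> _ [x /= x1 <-]; exact: le_trans (f1 x) x1.
apply: ub_le_sup; last by exists u; rewrite /unit_ball /= ?u1// fu normr1.
by exists 1 => _ [x /= x1 <-]; exact: le_trans (f1 x) x1.
Qed.

Lemma tangential_modulus_le f u v (t : R) : (forall x, `|f x| <= `|x|) ->
  `|u| = 1 -> f u = 1 -> `|v| = 1 -> f v = 0 ->
  0 <= 1 + tangential_modulus X t <= `|u + t *: v|.
Proof.
move=> f1 u1 fu v1 fv; rewrite /tangential_modulus; set S := (X in inf X).
have Suv : S (`|u + t *: v| - 1).
  exists u, v, f; split=> //; last by rewrite (norming_dual_norm f1 u1).
  split; first exact: contraction_continuous.
  by exists u; rewrite fu oner_eq0.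
have lbS : lbound S (-1).
  by move=> _ [x [w [g [_ _ _ _ ->]]]]; rewrite lerBrDl subrr.
have := lb_le_inf (ex_intro _ _ Suv) lbS.
have := ge_inf (ex_intro _ _ lbS) Suv; move: (inf S) => s; lra.
Qed.

Lemma uniform_convexityP (e : R) : uniformly_convex X -> 0 < e <= 2 ->
  exists2 eta : R, 0 < eta & forall x y, `|x| <= 1 -> `|y| <= 1 ->
    e <= `|x - y| -> `|2^-1 *: (x + y)| <= 1 - eta.
Proof.
move=> /[apply]; rewrite /convexity_modulus; set S := (X in ereal_inf X).
have SP x y : `|x| <= 1 -> `|y| <= 1 -> e <= `|x - y| ->
    (ereal_inf S <= (1 - `|2^-1 *: (x + y)|)%:E)%E.
  by move=> x1 y1 exy; apply: ereal_inf_lbound; exists (x, y).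
case: (ereal_inf S) SP => [eta| |] SP //.
  by rewrite lte_fin => eta0; exists eta => // x y x1 y1 /(SP _ _ x1 y1); rewrite lee_fin; lra.
by move=> _; exists 1 => // x y x1 y1 /(SP _ _ x1 y1).
Qed.

Lemma uniform_convexity_scaled (e : R) : uniformly_convex X -> 0 < e <= 2 ->
  exists2 eta : R, 0 < eta & forall r x y, 0 < r -> `|x| <= r -> `|y| <= r ->
    e * r <= `|x - y| -> `|2^-1 *: (x + y)| <= (1 - eta) * r.
Proof.
move=> UC e02; have [eta eta0 etaP] := uniform_convexityP UC e02.
exists eta => // r x y r0 xr yr exy.
have r'0 : 0 <= r^-1 by rewrite invr_ge0 ltW.
have := etaP (r^-1 *: x) (r^-1 *: y).
rewrite -scalerBr -scalerDr scalerA [_ * r^-1]mulrC -scalerA !normrZ ger0_norm//.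
rewrite !ler_pdivrMl// ler_pdivlMl// mulr1 [r * _]mulrC [r * _]mulrC.
exact.
Qed.

(** The comparison vector is [w + l v], with [w] the normalisation of [u] and
    [v] that of [x - f x w]; replacing [z] by [w] and [x] by [v] moves each by at
    most [2 d].  The positivity in the conclusion is there to let the factor
    [1 - 6 d] be decreased. *)
Lemma tangential_estimate (d : R) f u z x (l : R) : 0 < d -> 6 * d <= 1 ->
  (forall y, `|f y| <= `|y|) -> f u = `|u| -> `|z| = 1 -> `|z - u| <= d ->
  `|x| = 1 -> `|f x| <= d ->
  0 <= 1 + tangential_modulus X `|l| /\
  (1 - 6 * d) * (1 + tangential_modulus X `|l|) <= `|z + l *: x|.
Proof.
move=> d0 d1 f1 fu z1 zu x1 fx.
have fZ a y : f (a *: y) = a * f y by exact: linearZ.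
have u1 : `|1 - `|u| | <= d.
  by rewrite -z1; apply: le_trans (ler_dist_dist _ _) zu.
have nu0 : `|u| != 0.
  by apply/eqP => u0; move: u1; rewrite u0 subr0 normr1; lra.
pose w := `|u|^-1 *: u.
have w1 : `|w| = 1 by exact: normalized.
have fw : f w = 1 by rewrite fZ fu mulVf.
have zw : `|z - w| <= 2 * d.
  have := ler_distD u z w; rewrite [`|u - w|]distrC normalize_dist//; lra.
pose v0 := x - f x *: w.
clearbody w; have fv0 : f v0 = 0 by rewrite /v0 linearB fZ fw mulr1 subrr.
have xv0 : `|x - v0| <= d.
  by rewrite /v0 opprB addrC subrK normrZ w1 mulr1.
have v01 : `|1 - `|v0| | <= d.
  by rewrite -x1; apply: le_trans (ler_dist_dist _ _) xv0.
have nv0 : `|v0| != 0.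
  by apply/eqP => v00; move: v01; rewrite v00 subr0 normr1; lra.
pose v := `|v0|^-1 *: v0.
have v1 : `|v| = 1 by exact: normalized.
have fv : f v = 0 by rewrite fZ fv0 mulr0.
have xv : `|x - v| <= 2 * d.
  have := ler_distD v0 x v; rewrite [`|v0 - v|]distrC normalize_dist//; lra.
(* The modulus is evaluated at [|l|], so the sign of [l] goes to [v]. *)
pose s : R := if 0 <= l then 1 else -1.
have sl : `|l| * s = l.
  by rewrite /s; case: (leP 0 l) => l0; [rewrite ger0_norm ?mulr1|rewrite ltr0_norm// mulrNN mulr1].
have sv1 : `|s *: v| = 1.
  by rewrite normrZ v1 mulr1 /s; case: ifP => _; rewrite ?normrN normr1.
have fsv : f (s *: v) = 0 by rewrite fZ fv mulr0.
have /andP[m0 mle] := tangential_modulus_le `|l| f1 w1 fw sv1 fsv.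
rewrite scalerA sl in mle; split => //.
set N := `|w + l *: v| in mle.
have N1 : 1 <= N.
  apply: le_trans (f1 (w + l *: v)); have -> : f (w + l *: v) = 1 by rewrite linearD fZ fw fv mulr0 addr0.
  by rewrite normr1.
have Nl : `|l| <= N + 1.
  have -> : `|l| = `|l *: v| by rewrite normrZ v1 mulr1.
  have -> : l *: v = (w + l *: v) - w by rewrite addrC addKr.
  by apply: le_trans (ler_normB _ _) _; rewrite w1.
have Nz : N <= `|z + l *: x| + 2 * d + 2 * d * `|l|.
  rewrite /N; have -> : w + l *: v = (z + l *: x) - (z - w) - l *: (x - v).
    rewrite scalerBr !opprB [w - z]addrC [z + _ + _]addrACA subrr add0r [_ + w]addrC.
    by rewrite -addrA [_ + (_ - _)]addrC subrK.
  apply: le_trans (ler_normB _ _) _; rewrite normrZ.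
  apply: lerD; last by rewrite [leRHS]mulrC ler_wpM2l.
  by apply: le_trans (ler_normB _ _) _; rewrite lerD2l.
set m := 1 + tangential_modulus X `|l| in m0 mle *.
have : d * `|l| <= d * (N + 1) by rewrite ler_pM2l.
have : d * 1 <= d * N by rewrite ler_pM2l.
have : (1 - 6 * d) * m <= (1 - 6 * d) * N by rewrite ler_wpM2l// subr_ge0.
lra.
Qed.

(** A product of [K] copies of the line has a dense set indexed by finite lists
    of rational intervals; choosing a point in each nonempty box makes this
    hereditary, so that it applies to the image of [X] under [g]. *)
Lemma weakly_dense_family (K : eqType) (g : K -> X -> R) :
  exists a : seq (K * (rat * rat)) -> X, forall x (l : seq K) (e : R), 0 < e ->
    exists s, forall k, k \in l -> `|g k (a s) - g k x| < e.
Proof.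
pose box (s : seq (K * (rat * rat))) y := forall k p q, (k, (p, q)) \in s ->
  ratr p < g k y < ratr q.
have : forall s, exists y, (exists y', box s y') -> box s y.
  by move=> s; have [[y bsy]|nb] := pselect (exists y, box s y); [exists y|exists 0].
move=> /boolp.choice[a aP]; exists a => x l e e0.
have : forall k, exists pq : rat * rat, [/\ ratr pq.1 < g k x < ratr pq.2,
    g k x - ratr pq.1 < e & ratr pq.2 - g k x < e].
  move=> k; have [p] := @rat_in_itvoo R (g k x - e) (g k x) ltac:(lra).
  have [q] := @rat_in_itvoo R (g k x) (g k x + e) ltac:(lra).
  rewrite !in_itv /= => /andP[? ?] /andP[? ?]; exists (p, q) => /=.
  by split; [apply/andP; split|lra|lra].
move=> /boolp.choice[c cP]; pose s := [seq (k, c k) | k <- l].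
exists s => k kl; have bsx : box s x.
  by move=> j p q /mapP[i _ [-> pqE]]; have [] := cP i; rewrite -pqE.
have := aP s (ex_intro _ _ bsx) k (c k).1 (c k).2.
rewrite -surjective_pairing map_f// => /(_ isT) /andP[? ?].
have [_ ? ?] := cP k; rewrite ltr_norml; apply/andP; split; lra.
Qed.

End Geometry.

(** * A norming family of functionals bounds the density *)

Section NormingFamily.
Variables (R : realType) (X : normedModType R).

(** Let [r] be the least norm that can be approached by points agreeing
    approximately with [x] on finitely many [f i].  The norming hypothesis gives
    [d <= r].  If [y0] and [y] almost achieve [r] for suitable finite sets of
    indices, so does their midpoint, whose norm is then at least about [r];
    uniform convexity makes [y0] and [y] close.  As [y] may be required to agree
    with [x] at any further index, [y0] is close to [x] at all indices at once.
    The index [None] of the weakly dense family stands for the norm, so that the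
    chosen points can almost achieve [r]. *)
Lemma norming_family_dense (I : eqType) (f : I -> {linear X -> R^o}) (d : R) :
  uniformly_convex X -> 0 < d -> (forall i x, `|f i x| <= `|x|) ->
  (forall x, `|x| = 1 -> exists i, d <= `|f i x|) ->
  exists a : seq (option I * (rat * rat)) -> X,
    forall x (e : R), `|x| = 1 -> 0 < e -> exists s, `|x - a s| <= e.
Proof.
move=> UC d0 f1 fd.
pose g (k : option I) : X -> R := if k is Some i then f i else fun x => `|x|.
have [a aP] := weakly_dense_family g; exists a => x e x1 e0.
have fB i y z : f i (y - z) = f i y - f i z by exact: linearB.
have fZ i c y : f i (c *: y) = c * f i y by exact: linearZ.
pose P (r : R) := forall (l : seq I) (h : R), 0 < h ->
  exists2 y, `|y| <= r & forall i, i \in l -> `|f i y - f i x| <= h.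
pose E := [set r | P r].
have P1 : E 1 by move=> l h h0; exists x => [|i _]; rewrite ?x1// subrr normr0 ltW.
have Pd r : P r -> d <= r.
  move=> Pr; apply/ler_addgt0Pr => h h0; have [i di] := fd x x1.
  have [y yr /(_ i (mem_head _ _))] := Pr [:: i] h h0.
  have := f1 i y; have := ler_distD (f i y) 0 (f i x).
  by rewrite !sub0r !normrN; lra.
have Elb : has_lbound E by exists d => r /Pd.
pose r := inf E.
have dr : d <= r by apply: lb_le_inf; [exists 1|move=> s /Pd].
have r1 : r <= 1 by apply: ge_inf.
(* [c] is the relative distance fed to uniform convexity, and [t] the slack
   around [r], so small that the gain [eta] in the midpoint exceeds it. *)
pose c : R := Num.min 1 (d * e / 3).
have c0 : 0 < c by rewrite lt_min ltr01 divr_gt0// mulr_gt0.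
have c1 : c <= 1 by rewrite ge_min lexx.
have cde : 3 * c <= d * e.
  have : c <= d * e / 3 by rewrite ge_min lexx orbT.
  lra.
have [|eta eta0 etaP] := @uniform_convexity_scaled R X c UC.
  by rewrite c0; lra.
pose t : R := Num.min c (eta * r / 4).
have er0 : 0 < eta * r by rewrite mulr_gt0//; lra.
have t0 : 0 < t by rewrite lt_min c0 divr_gt0.
have tc : t <= c by rewrite ge_min lexx.
have te : 4 * t <= eta * r.
  have : t <= eta * r / 4 by rewrite ge_min lexx orbT.
  lra.
have Pup : P (r + t / 2).
  have [s Es sr] : exists2 s, E s & s < r + t / 2.
    by apply: inf_lt; [exists 1|rewrite ltrDl divr_gt0].
  by move=> l h h0; have [y ys yP] := Es l h h0; exists y => //; lra.
have [l0 [h0 [h00 l0P]]] : exists (l : seq I) (h : R), 0 < h /\ forall y,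
    (forall i, i \in l -> `|f i y - f i x| <= h) -> r - t < `|y|.
  apply: contrapT => nl0; have /forallNP nl := nl0.
  have : P (r - t).
    move=> l h h0; have /forallNP ny := nl l.
    apply: contrapT => ny'; apply: (ny h); split => // y yP.
    by rewrite ltNge; apply/negP => yr; apply: ny'; exists y.
  by move=> /(ge_inf Elb); rewrite -/r; lra.
(* [y0'] is replaced by a point [a s] of the family, at half the tolerance. *)
have [y0' y0'r y0'P] := Pup l0 (h0 / 2) ltac:(lra).
have [s sP] := aP y0' (None :: map Some l0) (Num.min (h0 / 2) (t / 2))
  ltac:(rewrite lt_min; apply/andP; split; lra).
exists s; set y0 := a s in sP *.
have y0r : `|y0| <= r + t.
  by have := sP None (mem_head _ _); rewrite lt_min /= => /andP[_]; rewrite ltr_norml => /andP[_]; lra.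
have y0P i : i \in l0 -> `|f i y0 - f i x| <= h0.
  move=> il; have := y0'P i il.
  have := sP (Some i); rewrite in_cons /= map_f// => /(_ isT).
  rewrite lt_min => /andP[+ _].
  have := ler_distD (f i y0') (f i y0) (f i x); lra.
have [->|xy0] := eqVneq x y0; first by rewrite subrr normr0 ltW.
have nxy0 : `|x - y0| != 0 by rewrite normr_eq0 subr_eq0.
have [i di] := fd _ (normalized nxy0).
have {}di : d * `|x - y0| <= `|f i x - f i y0|.
  move: di; rewrite fZ fB normrM normrV ?unitfE// normr_id.
  by rewrite ler_pdivlMl ?lt_neqAle 1?eq_sym ?nxy0 ?normr_ge0// mulrC.
(* The index [i] detects the distance from [y0] to [x]; [y] is asked to agree
   with [x] there too, while still competing with [y0] on [l0]. *)
have [y yr yP] := Pup (i :: l0) (Num.min h0 t) ltac:(rewrite lt_min; apply/andP; split; lra).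
have yx : `|f i y - f i x| <= t.
  by have := yP i (mem_head _ _); rewrite le_min => /andP[].
have mid : r - t < `|2^-1 *: (y0 + y)|.
  apply: l0P => j jl; rewrite fZ linearD.
  have := y0P j jl; have : `|f j y - f j x| <= h0.
    by have := yP j; rewrite in_cons jl orbT => /(_ isT); rewrite le_min => /andP[].
  rewrite !ler_norml => /andP[? ?] /andP[? ?]; apply/andP; split; lra.
have close : `|y0 - y| < 2 * c.
  rewrite ltNge; apply/negP => far.
  have := etaP (r + t) y0 y ltac:(lra) y0r ltac:(lra).
  have crt : c * (r + t) <= c * 2 by rewrite ler_pM2l//; lra.
  move=> /(_ ltac:(lra)).
  have : eta * t >= 0 by rewrite mulr_ge0// ltW.
  lra.
have fyy : `|f i y0 - f i y| <= 2 * c.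
  by rewrite -fB; apply: le_trans (f1 _ _) _; exact: ltW.
have : d * `|x - y0| <= d * e.
  have := ler_distD (f i y) (f i x) (f i y0).
  rewrite [`|f i x - f i y|]distrC [`|f i y - f i y0|]distrC; lra.
by rewrite ler_pM2l.
Qed.

End NormingFamily.

(** * Spans, nets and kernels *)

Section Spans.
Variables (R : realType) (X : normedModType R).
Implicit Types (x y z : X) (A S : set X).

Lemma linear_span_min A S : submod_closed [in S] -> A `<=` S ->
  linear_span A `<=` S.
Proof. exact: smallest_sub. Qed.

Lemma submod_closedP S : submod_closed [in S] <->
  S 0 /\ forall (a : R) x y, S x -> S y -> S (a *: x + y).
Proof.
split=> -[S0 Slin]; split.
- by move: S0; rewrite inE.
- by move=> a x y Sx Sy; have := Slin a x y; rewrite !inE; exact.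
- by rewrite inE.
- by move=> a x y; rewrite !inE; exact: Slin.
Qed.

Lemma linear_span_scale A (a : R) x : A x -> linear_span A (a *: x).
Proof.
move=> Ax S [/submod_closedP[S0 Slin] AS].
by rewrite -[_ *: _]addr0; apply: Slin => //; exact: AS.
Qed.

Lemma closure_approx S z (e : R) : closure S z -> 0 < e ->
  exists2 y, S y & `|z - y| < e.
Proof.
move=> Sz e0; have [|y [Sy]] := Sz (ball z e); first exact: nbhsx_ballx.
by rewrite -ball_normE /= => zy; exists y.
Qed.

Lemma approx_closure S z : (forall e : R, 0 < e -> exists2 y, S y & `|z - y| < e) ->
  closure S z.
Proof.
move=> H B /nbhs_ballP[e /= e0 eB]; have [y Sy zy] := H e e0.
by exists y; split => //; apply: eB; rewrite -ball_normE.
Qed.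

Definition rational_combination (K : Type) (b : K -> X) (c : seq (K * rat)) : X :=
  \sum_(p <- c) ratr p.2 *: b p.1.

(** The vectors that are limits of rational combinations form a subspace; in
    [a u + v] the scalar [a] is replaced by a rational before [u] is
    approximated, because the precision required on [u] depends on it. *)
Lemma rational_combination_dense (K : Type) (b : K -> X) z (e : R) :
  closure (linear_span (range b)) z -> 0 < e ->
  exists c, `|z - rational_combination b c| <= e.
Proof.
move=> + e0 => /closure_approx /(_ (divr_gt0 e0 (ltr0n R 2))) [y sy zy].
pose S := [set x | forall e : R, 0 < e -> exists c, `|x - rational_combination b c| <= e].
suff /(_ _ sy) /(_ (e / 2) ltac:(lra)) [c yc] : linear_span (range b) `<=` S.
  by exists c; have := ler_distD y z (rational_combination b c); lra.
apply: linear_span_min.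
  apply/submod_closedP; split.
    by move=> h h0; exists [::]; rewrite /rational_combination big_nil subrr normr0 ltW.
  move=> a u v Su Sv h h0.
  have u1 : 0 < `|u| + 1 by rewrite ltr_wpDl.
  pose k := h / 4 / (`|u| + 1).
  have k0 : 0 < k by rewrite !divr_gt0.
  have [q] := @rat_in_itvoo R a (a + k) ltac:(lra).
  rewrite in_itv /= => /andP[aq qa].
  have q1 : 0 < `|ratr q : R| + 1 by rewrite ltr_wpDl.
  have [cu ucu] := Su (h / 4 / (`|ratr q : R| + 1)) ltac:(by rewrite !divr_gt0).
  have [cv vcv] := Sv (h / 2) ltac:(lra).
  exists ([seq (p.1, q * p.2) | p <- cu] ++ cv).
  have -> : rational_combination b ([seq (p.1, q * p.2) | p <- cu] ++ cv) =
      ratr q *: rational_combination b cu + rational_combination b cv.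
    rewrite /rational_combination big_cat big_map /= scaler_sumr; congr (_ + _).
    by apply: eq_bigr => p _; rewrite rmorphM scalerA.
  set U := rational_combination b cu in ucu *.
  set V := rational_combination b cv in vcv *.
  have -> : a *: u + v - (ratr q *: U + V) =
      (a - ratr q) *: u + ratr q *: (u - U) + (v - V).
    by rewrite scalerBl scalerBr [_ - ratr q *: u + _]addrA subrK opprD addrACA.
  have t1 : `|(a - ratr q) *: u| <= h / 4.
    rewrite normrZ; apply: (@le_trans _ _ (k * (`|u| + 1))); last by rewrite divfK ?gt_eqF.
    apply: ler_pM => //; last by rewrite lerDl.
    rewrite distrC ger0_norm; lra.
  have t2 : `|ratr q *: (u - U)| <= h / 4.
    rewrite normrZ; have -> : h / 4 = (`|ratr q : R| + 1) * (h / 4 / (`|ratr q : R| + 1)).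
      by rewrite [RHS]mulrC divfK ?gt_eqF.
    by apply: ler_pM => //; rewrite lerDl.
  apply: le_trans (ler_normD _ _) _; apply: le_trans (lerD (ler_normD _ _) (lexx _)) _.
  lra.
move=> _ [k _ <-] h h0; exists [:: (k, 1%Q)].
by rewrite /rational_combination big_seq1 /= rmorph1 scale1r subrr normr0 ltW.
Qed.

Fixpoint combinations (b : seq X) : set X :=
  if b is a :: b' then [set x | exists t y, combinations b' y /\ x = t *: a + y]
  else [set 0].

Lemma combinations_submod b : submod_closed [in combinations b].
Proof.
apply/submod_closedP; elim: b => [|a b [IH0 IHlin]] /=.
  by split=> // a x y -> ->; rewrite scaler0 addr0.
split; first by exists 0, 0; rewrite scale0r addr0.
move=> c _ _ [s [x [bx ->]]] [t [y [byy ->]]].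
exists (c * s + t), (c *: x + y); split; first exact: IHlin.
by rewrite scalerDr scalerA scalerDl addrACA.
Qed.

Lemma mem_combinations b x : x \in b -> combinations b x.
Proof.
elim: b => [//|a b IH]; rewrite in_cons => /predU1P[->|/IH bx] /=.
  exists 1, 0; rewrite scale1r addr0; split => //.
  by have /submod_closedP[] := combinations_submod b.
by exists 0, x; rewrite scale0r add0r.
Qed.

Lemma linear_span_combinations b : linear_span [set` b] `<=` combinations b.
Proof.
apply: linear_span_min; first exact: combinations_submod.
by move=> x /=; exact: mem_combinations.
Qed.

Lemma combinations_linear_span b : combinations b `<=` linear_span [set` b].
Proof.
move=> x bx S [/submod_closedP[S0 Slin]]; elim: b x bx => [|a b IH] x /=; first by move=> ->.
move=> [t [y [byy ->]]] abS; apply: Slin; first by apply: abS; rewrite /= mem_head.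
by apply: IH => // z zb; apply: abS; rewrite /= in_cons [_ \in _]zb orbT.
Qed.

Lemma interval_net (L d : R) : 0 < d ->
  exists T : seq R, forall t, `|t| <= L -> exists2 s, s \in T & `|t - s| <= d.
Proof.
move=> d0; exists [seq - L + k%:R * d | k <- iota 0 (Num.trunc (2 * L / d)).+1].
move=> t; rewrite ler_norml => /andP[Lt tL].
have q0 : 0 <= (t + L) / d by rewrite divr_ge0 ?(ltW d0)//; lra.
have /andP[kl ku] := truncn_itv q0; set k := Num.trunc ((t + L) / d) in kl ku.
exists (- L + k%:R * d).
  apply/mapP; exists k => //; rewrite mem_iota /= add0n ltnS; apply: le_truncn.
  by rewrite ler_pM2r ?invr_gt0//; lra.
rewrite ler_pdivlMr// in kl; rewrite ltr_pdivrMr// -natr1 mulrDl mul1r in ku.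
rewrite ler_norml; apply/andP; split; lra.
Qed.

(** Induction on the spanning list [a :: b].  If [a] is a limit of combinations
    of [b], a net for the latter serves also for the former.  Otherwise [a] is at
    distance at least [e > 0] from them, which bounds both coordinates of
    [t a + y] in terms of its norm, and a product net works. *)
Lemma combinations_totally_bounded b (M d : R) : 0 < d ->
  exists N : seq X, forall x, combinations b x -> `|x| <= M ->
    exists2 u, u \in N & `|x - u| <= d.
Proof.
elim: b M d => [|a b IH] M d d0 /=.
  by exists [:: 0] => _ -> _; exists 0; rewrite ?mem_head// subrr normr0 ltW.
have /submod_closedP[b0 blin] := combinations_submod b.
have bZ (c : R) x : combinations b x -> combinations b (c *: x).
  by move=> bx; rewrite -[_ *: _]addr0; exact: blin.
have [near|/existsNP[e /not_implyP[e0 far]]] :=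
    pselect (forall e : R, 0 < e -> exists2 v, combinations b v & `|a - v| < e).
  have [N NP] := IH (M + d / 2) (d / 2) ltac:(lra).
  exists N => _ [t [y [byy ->]]] xM.
  have t1 : 0 < `|t| + 1 by rewrite ltr_wpDl.
  have [v bv av] := near (d / 2 / (`|t| + 1)) ltac:(by rewrite !divr_gt0).
  have xtv : `|(t *: a + y) - (t *: v + y)| <= d / 2.
    rewrite [t *: v + y]addrC addrKA -scalerBr normrZ.
    have -> : d / 2 = (`|t| + 1) * (d / 2 / (`|t| + 1)).
      by rewrite [RHS]mulrC divfK ?gt_eqF.
    by apply: ler_pM => //; [rewrite lerDl|exact: ltW].
  have [||u uN vu] := NP (t *: v + y); first exact: blin.
    have := lerB_dist (t *: v + y) (t *: a + y); rewrite distrC; lra.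
  exists u => //; have := ler_distD (t *: v + y) (t *: a + y) u; lra.
have {}far v : combinations b v -> e <= `|a - v|.
  by move=> bv; rewrite leNgt; apply/negP => av; apply: far; exists v.
have a1 : 0 < `|a| + 1 by rewrite ltr_wpDl.
have [N NP] := IH (M + M / e * `|a|) (d / 2) ltac:(lra).
have [T TP] := interval_net (M / e) (ltac:(by rewrite !divr_gt0) : 0 < d / 2 / (`|a| + 1)).
exists [seq s *: a + u | s <- T, u <- N] => _ [t [y [byy ->]]] xM.
have tM : `|t| <= M / e.
  rewrite ler_pdivlMr//; apply: le_trans xM.
  have [->|t0] := eqVneq t 0; first by rewrite normr0 mul0r.
  have -> : t *: a + y = t *: (a - (- t^-1) *: y).
    by rewrite scaleNr opprK scalerDr scalerA mulfV// scale1r.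
  by rewrite normrZ ler_wpM2l//; apply: far; exact: bZ.
have yM : `|y| <= M + M / e * `|a|.
  have -> : y = (t *: a + y) - t *: a by rewrite addrC addKr.
  by apply: le_trans (ler_normB _ _) _; rewrite lerD// normrZ ler_wpM2r.
have [s sT ts] := TP t tM; have [u uN yu] := NP y byy yM.
exists (s *: a + u); first exact: allpairs_f.
have -> : t *: a + y - (s *: a + u) = (t - s) *: a + (y - u).
  by rewrite scalerBl opprD addrACA.
apply: le_trans (ler_normD _ _) _; rewrite normrZ.
have : `|t - s| * `|a| <= d / 2.
  have -> : d / 2 = d / 2 / (`|a| + 1) * (`|a| + 1) by rewrite divfK ?gt_eqF.
  by apply: ler_pM => //; rewrite lerDl.
lra.
Qed.

(** Each functional that does not vanish on the previous joint kernel
    contributes one vector to a finite-dimensional complement. *)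
Lemma joint_kernel_cofinite (I : eqType) (f : I -> {linear X -> R^o}) (l : seq I) :
  exists b : seq X, forall x, exists2 y, combinations b y &
    forall i, i \in l -> f i (x - y) = 0.
Proof.
have fB i y z : f i (y - z) = f i y - f i z by exact: linearB.
have fZ i c y : f i (c *: y) = c * f i y by exact: linearZ.
elim: l => [|i l [b bP]]; first by exists [::] => x; exists 0.
have [ker|/existsNP[v /not_implyP[lv iv]]] :=
    pselect (forall v, (forall j, j \in l -> f j v = 0) -> f i v = 0).
  exists b => x; have [y byy yP] := bP x; exists y => // j.
  by rewrite in_cons => /predU1P[->|/yP//]; exact: ker.
exists (v :: b) => x; have [y byy yP] := bP x.
pose t := f i (x - y) / f i v.
exists (t *: v + y); first by exists t, y.
move=> j; rewrite opprD addrA addrAC fB fZ in_cons => /predU1P[->|jl].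
  by rewrite divfK ?subrr//; apply/eqP.
by rewrite yP// lv// mulr0 subrr.
Qed.

End Spans.

(** * Vectors almost annihilated by the norming functionals of a net *)

Section AlmostOrthogonal.
Variables (R : realType) (X : normedModType R) (T : Type) (kappa : set T).
Hypothesis kappa_infinite : infinite_set kappa.
Hypothesis X_density : is_density (@setT X) kappa.
Variable (F : X -> {linear X -> R^o}).
Hypothesis F_contraction : forall u x, `|F u x| <= `|x|.

Lemma density_not_combinations (b : seq X) : exists x, ~ combinations b x.
Proof.
apply: contrapT => /forallNP ball; apply: kappa_infinite.
apply: (card_le_finite (X_density.2 [set` b] _)); last exact: finite_seq.
split=> // x _; apply: subset_closure; apply: combinations_linear_span.
exact: contrapT (ball x).
Qed.

Lemma finite_net_orthogonal (A : set X) (d : R) : finite_set A -> 0 < d ->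
  exists N : set X,
    (forall z, closure (linear_span A) z -> `|z| = 1 -> exists2 u, N u & `|z - u| <= d)
    /\ exists2 x, `|x| = 1 & forall u, N u -> `|F u x| <= d.
Proof.
move=> /finite_seqP[b ->] d0.
have [N NP] := combinations_totally_bounded b (1 + d / 2) (ltac:(lra) : 0 < d / 2).
exists [set` N]; split.
  move=> z /closure_approx/(_ (ltac:(lra) : 0 < d / 2)) [y yb zy] z1.
  have [||u uN yu] := NP y; first exact: linear_span_combinations.
    by have := lerB_dist y z; rewrite distrC; lra.
  by exists u => //; have := ler_distD y z u; lra.
have [c cP] := joint_kernel_cofinite F N.
have [x0 nx0] := density_not_combinations c.
have [y cy yP] := cP x0.
have nk : `|x0 - y| != 0.
  by rewrite normr_eq0 subr_eq0; apply/eqP => x0y; apply: nx0; rewrite x0y.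
exists (`|x0 - y|^-1 *: (x0 - y)); first exact: normalized.
move=> u /yP Fu; have -> : F u (`|x0 - y|^-1 *: (x0 - y)) = `|x0 - y|^-1 * F u (x0 - y).
  exact: linearZ.
by rewrite Fu mulr0 normr0 ltW.
Qed.

(** The net is the set of rational combinations of [A]. A family of functionals
    indexed by it cannot be norming: the resulting dense subset of [X] would have
    at most the cardinality of [A]. *)
Lemma infinite_net_orthogonal (A : set X) (d : R) : uniformly_convex X ->
  infinite_set A -> ~~ (kappa #<= A) -> 0 < d ->
  exists N : set X,
    (forall z, closure (linear_span A) z -> `|z| = 1 -> exists2 u, N u & `|z - u| <= d)
    /\ exists2 x, `|x| = 1 & forall u, N u -> `|F u x| <= d.
Proof.
move=> UC Ainf kA d0.
pose b (k : A) : X := val k.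
have rb : range b = A.
  apply/seteqP; split=> [_ [k _ <-]|x Ax]; first exact: set_valP.
  by exists (SigSub (mem_set Ax)).
exists (range (rational_combination b)); split.
  move=> z Az _; have [|c zc] := @rational_combination_dense R X A b z d _ d0.
    by rewrite rb.
  by exists (rational_combination b c) => //; exists c.
apply: contrapT => no_x; move/negP: kA; apply.
have Kinf : infinite_set [set: A].
  by move=> Kfin; apply: Ainf; rewrite -rb; exact: finite_image.
pose f (c : seq (A * rat)) := F (rational_combination b c).
have [||a aP] := @norming_family_dense R X _ f d UC d0.
- by move=> c x; exact: F_contraction.
- move=> x x1; apply: contrapT => /forallNP nc; apply: no_x; exists x => //.
  by move=> _ [c _ <-]; rewrite leNgt; apply/negP => /ltW; exact: nc.
have small : embeds (seq (option (seq (A * rat)) * (rat * rat))) A.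
  apply: (embeds_words Kinf); apply: (embeds_prod_countable Kinf).
  apply: (embeds_option Kinf); apply: (embeds_words Kinf).
  by apply: (embeds_prod_countable Kinf); exists id.
apply: card_le_trans (X_density.2 (range a) _) _; last first.
  apply: card_le_trans (card_image_le _ _) _.
  apply: card_le_trans (embeds_card_le small) _.
  by have /card_eqPle[] := card_setT A.
split=> // x _; apply: approx_closure => e e0.
have [->|x0] := eqVneq x 0.
  exists (0 *: a [::]); last by rewrite scale0r subrr normr0.
  by apply: linear_span_scale; exists [::].
have nx : `|x| != 0 by rewrite normr_eq0.
have nx0 : 0 < `|x| by rewrite normr_gt0.
have [s sP] := aP _ (e / 2 / `|x|) (normalized nx) ltac:(by rewrite !divr_gt0).
exists (`|x| *: a s); first by apply: linear_span_scale; exists s.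
have -> : x - `|x| *: a s = `|x| *: (`|x|^-1 *: x - a s).
  by rewrite scalerBr scalerA mulfV// scale1r.
rewrite normrZ normr_id; apply: (@le_lt_trans _ _ (e / 2)); last lra.
by rewrite mulrC -ler_pdivlMr.
Qed.

End AlmostOrthogonal.

Theorem theorem6p5 (R : realType) (X : normedModType R)
    (T : Type) (kappa : set T)
    (kappa_infinite : infinite_set kappa)
    (X_uniformly_convex : uniformly_convex X)
    (X_density : is_density (@setT X) kappa) :
  octahedral_lt X kappa (tangential_modulus X).
Proof.
move=> eps Z eps0 _ [D [[[A [_ ZA] AD] _] _ kD]].
have [F FP] := boolp.choice (@norming_functional R X).
(* The cap at 1 keeps the factor [1 - 6 d] nonnegative when [eps > 1]. *)
pose d := Num.min eps 1 / 6.
have [d0 [d1 de]] : 0 < d /\ 6 * d <= 1 /\ 6 * d <= eps.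
  have m0 : 0 < Num.min eps 1 by rewrite lt_min eps0 ltr01.
  have : Num.min eps 1 <= 1 by rewrite ge_min lexx orbT.
  have : Num.min eps 1 <= eps by rewrite ge_min lexx.
  by rewrite /d; lra.
have [N [Nnet [x x1 xN]]] : exists N : set X,
    (forall z, closure (linear_span A) z -> `|z| = 1 -> exists2 u, N u & `|z - u| <= d)
    /\ exists2 x, `|x| = 1 & forall u, N u -> `|F u x| <= d.
  have F1 u y : `|F u y| <= `|y| by have [] := FP u.
  have [Afin|Ainf] := pselect (finite_set A).
    exact: (finite_net_orthogonal kappa_infinite X_density).
  apply: (infinite_net_orthogonal X_density) => //.
  apply: contra kD => kA; apply: card_le_trans kA _.
  by have /card_eqPle[] := AD.
exists x => // z l Zz z1.
have [u Nu zu] := Nnet z (ZA z Zz) z1.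
have [f1 fu] := FP u.
have [m0 mle] := tangential_estimate l d0 d1 f1 fu z1 zu x1 (xN u Nu).
apply: le_trans mle; apply: ler_wpM2r => //; lra.
Qed.
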